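(* Let $\ell_1,\dots,\ell_T:\mathbb{R}^d\to\mathbb{R}$ be $G$-Lipschitz convex functions ($G>0$) and $g_t\in\partial\ell_t(w_t)$ for all $t$, where $w_t$ are the iterates defined below. Let $\epsilon>0$, $k\ge3$, $V_t=4G^2+\sum_{s=1}^{t-1}\|g_s\|^2$, $\alpha_t=\frac{\epsilon G}{\sqrt{V_t}\log^2(V_t/G^2)}$, and for all $t$ set $$\psi_t(w)=k\int_0^{\|w\|}\min_{0<\eta\le1/G}\left[\frac{\log(x/\alpha_t+1)}{\eta}+\eta V_t\right]dx.$$ Let $w_1=0$ and $$w_{t+1}=\arg\min_{w\in\mathbb{R}^d}\ \langle g_t,w\rangle+D_{\psi_t}(w|w_t)+\Delta_t(w),\qquad\Delta_t(w)=D_{\psi_{t+1}}(w|w_1)-D_{\psi_t}(w|w_1).$$ Then for all $u\in\mathbb{R}^d$, $$\sum_{t=1}^T\big(\ell_t(w_t)-\ell_t(u)\big)\le4G\epsilon+2k\|u\|\max\left\{\sqrt{V_{T+1}\log\left(\frac{\|u\|}{\alpha_{T+1}}+1\right)},\ G\log\left(\frac{\|u\|}{\alpha_{T+1}}+1\right)\right\}.$$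
   Context: $\|\cdot\|$ is the Euclidean norm, $\log$ the natural logarithm. For differentiable $\psi$, $D_\psi(x|y)=\psi(x)-\psi(y)-\langle\nabla\psi(y),x-y\rangle$. The minimum over $\eta$ in the integrand is an infimum (equal to $0$) at $x=0$. For $k=3$ the update has the closed form $w_{t+1}=\frac{\alpha_{t+1}\theta_{t+1}}{\|\theta_{t+1}\|}\left[\exp(f_{t+1}(\theta_{t+1}))-1\right]$ with $\theta_{t+1}=-\sum_{s\le t}g_s$ (and $w_{t+1}=0$ if $\theta_{t+1}=0$), where $f_{t+1}(\theta)=\frac{\|\theta\|^2}{36V_{t+1}}$ if $\|\theta\|\le\frac{6V_{t+1}}{G}$ and $f_{t+1}(\theta)=\frac{\|\theta\|}{3G}-\frac{V_{t+1}}{G^2}$ otherwise. *)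

(* Defs.v *)
From HB Require Import structures.
From mathcomp Require Import all_boot all_order all_algebra.
From mathcomp Require Import all_classical all_reals all_analysis.

Set Implicit Arguments.
Unset Strict Implicit.
Unset Printing Implicit Defensive.

Import Order.TTheory GRing.Theory Num.Theory.
Import numFieldNormedType.Exports.

Local Open Scope classical_set_scope.
Local Open Scope ring_scope.

Section Euclidean.
Context {R : realType} {d : nat}.
Implicit Types (x y v w : 'rV[R]_d) (f psi : 'rV[R]_d -> R).

Definition dot x y : R := \sum_(i < d) x 0 i * y 0 i.

(* The library norm `|x| on row vectors is the sup norm, so the Euclidean norm
   (and Lipschitz continuity with respect to it) is defined separately. *)
Definition enorm x : R := Num.sqrt (dot x x).

Definition elipschitz (G : R) f : Prop :=
  forall x y, `|f x - f y| <= G * enorm (x - y).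

Definition subdifferential f x : set 'rV[R]_d :=
  [set g | forall y, f x + dot g (y - x) <= f y].

Definition gradient psi y : 'rV[R]_d :=
  \row_(i < d) 'D_(delta_mx 0 i) psi y.

Definition bregman psi x y : R :=
  psi x - psi y - dot (gradient psi y) (x - y).

Definition argmin f : set 'rV[R]_d := [set w | forall v, f w <= f v].

End Euclidean.

Section MirrorDescent.
Context {R : realType} {d : nat}.
Variables (G eps k : R) (g : nat -> 'rV[R]_d).

(* Rounds are numbered from 1; the values at index 0 are irrelevant. *)
Definition Vsum (t : nat) : R :=
  4 * G ^+ 2 + \sum_(1 <= s < t) enorm (g s) ^+ 2.

Definition alpha (t : nat) : R :=
  eps * G / (Num.sqrt (Vsum t) * ln (Vsum t / G ^+ 2) ^+ 2).

(* An infimum because at x = 0 the minimum over ]0, 1/G] is not attained. *)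
Definition psi_slope (t : nat) (x : R) : R :=
  inf [set ln (x / alpha t + 1) / eta + eta * Vsum t
      | eta in [set eta : R | 0 < eta <= 1 / G]].

Definition psi (t : nat) (w : 'rV[R]_d) : R :=
  k * \int[@lebesgue_measure R]_(x in `[0, enorm w]) psi_slope t x.

Definition Delta (w1 : 'rV[R]_d) (t : nat) (w : 'rV[R]_d) : R :=
  bregman (psi t.+1) w w1 - bregman (psi t) w w1.

Definition md_objective (w : nat -> 'rV[R]_d) (t : nat) (v : 'rV[R]_d) : R :=
  dot (g t) v + bregman (psi t) v (w t) + Delta (w 1%N) t v.

End MirrorDescent.

(* Main.v *)
(* The correction [Delta] turns the mirror descent steps into a single
   follow-the-regularized-leader scheme: with [theta_t] minus the sum of the first
   [t - 1] subgradients, [grad psi_t (w_t) = theta_t]. Since [psi_t] is radial, its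
   conjugate is radial too, with derivative
     [r_t s = alpha_t (exp (f_t s) - 1)],
     [f_t s = max of e s / k - e^2 V_t over 0 <= e <= 1/G],
   so [|w_t| = r_t |theta_t|] and the regret is at most [psi_{T+1} u] plus the sum of
   the increments [psi*_{t+1} (theta_t - g_t) - psi*_t theta_t + <g_t, w_t>]. Each of
   these is at most [2 alpha_t |g_t|^2 / sqrt V_t]: when [|theta_t| <= 3 sqrt V_t]
   because [r_t] is Lipschitz there, and beyond because the decrease of [f] due to
   [V_{t+1} = V_t + |g_t|^2] absorbs the second order term. The choice of [alpha_t]
   makes the sum of these errors telescope along [1 / ln (V_t / G^2)]. *)
Require Import Defs.
From mathcomp Require Import all_boot all_order all_algebra.
From mathcomp Require Import all_classical all_reals all_analysis.
From mathcomp Require Import ring lra.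
Import Order.TTheory GRing.Theory Num.Theory.
Import numFieldNormedType.Exports.
Local Open Scope classical_set_scope.
Local Open Scope ring_scope.

(** * Convex functions on the line and their supporting slopes *)

Section SupportingSlope.
Context {R : realType}.
Implicit Types phi m f df : R -> R.

(** [m] selects a subgradient of [phi] at every point. This encodes convexity and, where [m] is
    continuous, differentiability with derivative [m]. *)
Definition supports phi m : Prop :=
  forall x y, m y * (x - y) <= phi x - phi y.

(** The support inequalities at [0] and at [h] squeeze the difference quotient between [m 0] and
    [m h]. *)
Lemma supports_cvg phi m : supports phi m -> {for 0, continuous m} ->
  h^-1 * (phi h - phi 0) @[h --> 0^'] --> m 0.
Proof.
move=> sm cm; apply/cvgrPdist_le => /= e e0.
have /cvgrPdist_le /(_ e e0) cme : m x @[x --> 0] --> m 0 := cm.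
near=> h.
have h0 : h != 0 by near: h; exact: nbhs_dnbhs_neq.
have hle : `|m 0 - m h| <= e by near: h; apply: nbhs_dnbhs.
apply: le_trans hle.
have lo := sm h 0; have up := sm 0 h.
rewrite subr0 in lo; rewrite sub0r in up.
set q := h^-1 * _.
have qE : phi h - phi 0 = q * h by rewrite /q mulrAC mulVf ?mul1r.
have lo1 : m 0 * h <= q * h by rewrite -qE.
have up1 : q * h <= m h * h by rewrite -qE; lra.
case: (ltgtP h 0) h0 => // hs _.
- rewrite !ler_nM2r // in lo1 up1.
  by rewrite !ger0_norm; lra.
- rewrite !ler_pM2r // in lo1 up1.
  by rewrite !ler0_norm; lra.
Unshelve. all: by end_near. Qed.

Lemma supports_is_derive phi m y : supports phi m -> {for y, continuous m} ->
  is_derive y 1 phi (m y).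
Proof.
move=> sm cm.
pose phi1 h := phi (h + y); pose m1 h := m (h + y).
have s1 : supports phi1 m1.
  by move=> x z; have := sm (x + y) (z + y); rewrite /m1 /phi1 opprD addrACA subrr addr0.
have c1 : {for 0, continuous m1}.
  apply: (@continuous_comp _ _ _ (fun h : R => h + y) m) => /=.
    by apply: continuousD; [exact: cvg_id|exact: cvg_cst].
  by rewrite add0r.
have /= := supports_cvg _ _ s1 c1; rewrite /phi1 /m1 !add0r => cv.
have cv' : h^-1 *: (phi (h *: 1 + y) - phi y) @[h --> 0^'] --> m y.
  by under eq_fun do rewrite [_ *: 1]mulr1.
split; first by apply/cvg_ex; exists (m y).
exact: cvg_lim.
Qed.

Lemma nondecreasing_is_derive f df (a b : R) :
  (forall x : R, is_derive x 1 f (df x)) -> a <= b ->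
  (forall x, a <= x <= b -> 0 <= df x) -> f a <= f b.
Proof.
move=> fd ab dge0.
have [|c cab E] := @MVT_segment _ f df a b ab (fun x _ => fd x).
  apply: continuous_subspaceT => x; apply: differentiable_continuous.
  by apply/derivable1_diffP; case: (fd x).
by rewrite -subr_ge0 E mulr_ge0 ?subr_ge0 // dge0 // -in_itv.
Qed.

Lemma increment_le_is_derive f df phi m (a b : R) :
  (forall x : R, is_derive x 1 f (df x)) ->
  (forall x : R, is_derive x 1 phi (m x)) -> a <= b ->
  (forall x, a <= x <= b -> df x <= m x) -> f b - f a <= phi b - phi a.
Proof.
move=> fd phid ab dle.
have : (phi - f) a <= (phi - f) b.
  apply: (nondecreasing_is_derive _ (fun x => m x - df x) _ _ _ ab) => x.
  by move/dle; rewrite -subr_ge0.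
rewrite -[(phi - f) a]/(phi a - f a) -[(phi - f) b]/(phi b - f b); lra.
Qed.

Lemma supports_scaled_sqr (c : R) : 0 <= c ->
  supports (fun x => c * x ^+ 2) ( *%R (c * 2)).
Proof.
move=> c0 x y; have : 0 <= c * (x - y) ^+ 2 by rewrite mulr_ge0 ?sqr_ge0.
lra.
Qed.

(* Convexity of [phi \o sqrt], as a tangent inequality in the variable [x ^+ 2]. *)
Lemma supports_sqr phi m (s x : R) : supports phi m -> continuous m ->
  (forall y z, 0 <= y <= z -> z * m y <= y * m z) -> 0 <= m s ->
  0 < s -> 0 <= x -> m s / (2 * s) * (x ^+ 2 - s ^+ 2) <= phi x - phi s.
Proof.
move=> sm cm ratio ms0 s0 x0; set c := m s / (2 * s).
have c0 : 0 <= c by rewrite divr_ge0 // mulr_ge0 // ltW.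
(* The parabola [c * t ^+ 2] has slope [m s] at [s]. As [m t / t] is nondecreasing, [phi] is at
   least as steep as the parabola to the right of [s] and at most as steep to the left. *)
have cE t : c * 2 * t = t * m s / s by rewrite /c; field; rewrite gt_eqF.
have dphi (t : R) : is_derive t 1 phi (m t) by exact: (supports_is_derive phi m t sm (cm t)).
have dsq (t : R) : is_derive t 1 (fun z => c * z ^+ 2) (c * 2 * t).
  apply: (supports_is_derive _ _ t (supports_scaled_sqr c c0)).
  exact: mulrl_continuous.
have [sx|xs] := leP s x.
  have := increment_le_is_derive _ _ _ _ _ _ dsq dphi sx; rewrite mulrBr; apply.
  move=> t /andP[st _]; rewrite cE ler_pdivrMr // [leRHS]mulrC.
  by apply: ratio; rewrite (ltW s0).
have := increment_le_is_derive _ _ _ _ _ _ dphi dsq (ltW xs) => H.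
have : phi s - phi x <= c * s ^+ 2 - c * x ^+ 2.
  apply: H => t /andP[xt ts]; rewrite cE ler_pdivlMr // mulrC.
  by apply: ratio; rewrite ts (le_trans x0 xt).
rewrite mulrBr; lra.
Qed.

End SupportingSlope.

(** * The derivative of the radial conjugate *)

Section DualRadius.
Context {R : realType}.
Variables (G k V a : R).
Hypotheses (G0 : 0 < G) (k0 : 0 < k) (V0 : 0 < V) (a0 : 0 < a).

(** The vertex [s / (2 * k * V)] clipped to [[0, 1/G]]. The clip at [0] makes [lograd] and [dualrad]
    vanish for [s <= 0], so that both are differentiable on the whole line. *)
Definition rate (s : R) : R := Num.max 0 (Num.min (s / (2 * k * V)) (1 / G)).
Definition lograd (s : R) : R := rate s * s / k - rate s ^+ 2 * V.
Definition dualrad (s : R) : R := a * (expR (lograd s) - 1).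

Lemma rate_ge0 s : 0 <= rate s.
Proof. by rewrite /rate le_max lexx. Qed.

Lemma rate_le s : rate s <= 1 / G.
Proof. by rewrite /rate ge_max ge_min lexx orbT divr_ge0 // ltW. Qed.

Lemma rate_lin (s : R) : 0 <= s -> rate s <= s / (2 * k * V).
Proof.
move=> s0; rewrite /rate ge_max ge_min lexx andbT divr_ge0 //.
by rewrite !mulr_ge0 // ltW.
Qed.

Lemma rate_npos (s : R) : s <= 0 -> rate s = 0.
Proof.
move=> s0; apply/max_idPl; rewrite ge_min; apply/orP; left.
by rewrite pmulr_lle0 // invr_gt0 !mulr_gt0.
Qed.

Lemma rate_pos (s : R) : 0 <= s -> rate s = Num.min (s / (2 * k * V)) (1 / G).
Proof.
move=> s0; apply/max_idPr; by rewrite le_min; apply/andP; split; rewrite divr_ge0 ?mulr_ge0 // ltW.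
Qed.

Lemma rate_continuous : continuous rate.
Proof.
move=> s; apply: (@continuous_max R R (cst 0)
  ((fun x => x / (2 * k * V)) \min cst (1 / G)) s); first exact: cvg_cst.
apply: continuous_min; last exact: cvg_cst.
by apply: continuousM; [exact: cvg_id|exact: cvg_cst].
Qed.

(* [rate s] maximises the concave quadratic [e s / k - e^2 V] over [0, 1/G]. *)
Lemma lograd_max (e s : R) : 0 <= e <= 1 / G ->
  e * s / k - e ^+ 2 * V + V * (rate s - e) ^+ 2 <= lograd s.
Proof.
move=> /andP[e0 eG].
(* Expansion of the quadratic about [rate s]. The last product is the first order term, nonnegative
   because [rate s] is the projection of the vertex onto [[0, 1/G]]. *)
have -> : lograd s = e * s / k - e ^+ 2 * V + V * (rate s - e) ^+ 2 +
    (rate s - e) * (s / k - 2 * V * rate s) by rewrite /lograd; field; rewrite ?gt_eqF.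
rewrite lerDl; have [sn|sp] := leP s 0.
  rewrite rate_npos // mulr0 subr0 sub0r mulNr -mulrN mulr_ge0 //.
  by rewrite -mulNr divr_ge0 ?oppr_ge0 // ltW.
have -> : s / k - 2 * V * rate s = 2 * V * (s / (2 * k * V) - rate s) by field; rewrite ?gt_eqF.
rewrite rate_pos ?(ltW sp) //.
case: (leP (s / (2 * k * V)) (1 / G)) => h; first by rewrite subrr !mulr0.
by rewrite !mulr_ge0 ?subr_ge0 // ltW.
Qed.

(** Envelope argument: [lograd] is a maximum of functions affine in [s], and the competitor [rate y]
    at [x] yields the tangent at [y]. *)
Lemma lograd_supports : supports lograd (fun s => rate s / k).
Proof.
move=> x y; have := @lograd_max (rate y) x; rewrite rate_ge0 rate_le => /(_ isT).
have : 0 <= V * (rate x - rate y) ^+ 2 by rewrite mulr_ge0 ?sqr_ge0 // ltW.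
have -> : rate y / k * (x - y) = rate y * x / k - rate y ^+ 2 * V - lograd y.
  by rewrite /lograd; ring.
lra.
Qed.

Lemma lograd_is_derive (s : R) : is_derive s 1 lograd (rate s / k).
Proof.
apply: (supports_is_derive _ _ s lograd_supports).
by apply: continuousM; [exact: rate_continuous|exact: cvg_cst].
Qed.

Lemma lograd_continuous : continuous lograd.
Proof.
by move=> s; apply/differentiable_continuous/derivable1_diffP; case: (lograd_is_derive s).
Qed.

Lemma lograd_ge0 s : 0 <= lograd s.
Proof.
have := @lograd_max 0 s; rewrite lexx divr_ge0 ?ler01 ?(ltW G0) // => /(_ isT).
have : 0 <= V * (rate s - 0) ^+ 2 by rewrite mulr_ge0 ?sqr_ge0 // ltW.
lra.
Qed.

Lemma lograd_npos (s : R) : s <= 0 -> lograd s = 0.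
Proof. by move=> s0; rewrite /lograd rate_npos //; lra. Qed.

Lemma lograd_le (s : R) : 0 <= s -> lograd s <= rate s * s / k.
Proof. by move=> s0; rewrite /lograd gerBl mulr_ge0 ?sqr_ge0 // ltW. Qed.

Lemma dualrad_supports : supports dualrad (fun s => a * (expR (lograd s) * (rate s / k))).
Proof.
move=> x y; rewrite /dualrad -mulrBr -mulrA ler_pM2l //.
have -> : expR (lograd x) = expR (lograd y) * expR (lograd x - lograd y).
  by rewrite -expRD; congr expR; ring.
have := lograd_supports x y; have := expR_ge1Dx (lograd x - lograd y).
set X := expR (_ - _); set E := expR _ => hX hl.
have -> : E * X - 1 - (E - 1) = E * (X - 1) by ring.
by rewrite -mulrA ler_pM2l ?expR_gt0 //; lra.
Qed.

Lemma dualrad_is_derive (s : R) : is_derive s 1 dualrad (a * (expR (lograd s) * (rate s / k))).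
Proof.
apply: (supports_is_derive _ _ s dualrad_supports).
apply: continuousM; first exact: cvg_cst.
apply: continuousM.
  by apply: continuous_comp; [exact: lograd_continuous|exact: continuous_expR].
by apply: continuousM; [exact: rate_continuous|exact: cvg_cst].
Qed.

Lemma dualrad_continuous : continuous dualrad.
Proof.
by move=> s; apply/differentiable_continuous/derivable1_diffP; case: (dualrad_is_derive s).
Qed.

Lemma dualrad_ge0 s : 0 <= dualrad s.
Proof.
by rewrite /dualrad mulr_ge0 ?(ltW a0) // subr_ge0 -expR0 ler_expR lograd_ge0.
Qed.

Lemma dualrad_npos (s : R) : s <= 0 -> dualrad s = 0.
Proof. by move=> s0; rewrite /dualrad lograd_npos // expR0 subrr mulr0. Qed.

(** Convexity and the value [0] at [0], first for [lograd] and then for [exp - 1], make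
    [dualrad s / s] nondecreasing, as [supports_sqr] requires. *)
Lemma dualrad_ratio (x y : R) : 0 <= x <= y -> y * dualrad x <= x * dualrad y.
Proof.
move=> /andP[x0 xy].
have [->|yn0] := eqVneq y 0; first by rewrite mul0r mulr_ge0 // dualrad_ge0.
have y0 : 0 < y by rewrite lt_neqAle eq_sym yn0 (le_trans x0).
pose t := x / y.
have xE : x = t * y by rewrite /t divfK.
have t0 : 0 <= t by rewrite divr_ge0 // ltW.
have t1 : t <= 1 by rewrite ler_pdivrMr // mul1r.
have fle : lograd x <= t * lograd y.
  have lx : lograd x = t * (rate x * y / k) - rate x ^+ 2 * V.
    by rewrite /lograd {2}xE; ring.
  have := @lograd_max (rate x) y; rewrite rate_ge0 rate_le => /(_ isT) h1.
  have h2 : 0 <= V * (rate y - rate x) ^+ 2 by rewrite mulr_ge0 ?sqr_ge0 // ltW.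
  have h3 : 0 <= (1 - t) * (rate x ^+ 2 * V).
    by rewrite mulr_ge0 ?subr_ge0 // mulr_ge0 ?sqr_ge0 // ltW.
  have h4 : t * (rate x * y / k - rate x ^+ 2 * V) <= t * lograd y.
    by rewrite ler_wpM2l //; lra.
  rewrite lx; move: h3 h4; set A := rate x * y / k; set B := rate x ^+ 2 * V.
  lra.
have ex : expR (lograd x) - 1 <= t * (expR (lograd y) - 1).
  have hz := lograd_ge0 y; set z := lograd y in fle hz *.
  have h0 : expR (lograd x) <= expR (t * z) by rewrite ler_expR.
  (* The tangent of [exp] at [t * z], evaluated at [z] here and at [0] in [e2]; with weights [t] and
     [1 - t] the linear terms cancel. *)
  have e1 : expR (t * z) * (1 + (1 - t) * z) <= expR z.
    have -> : expR z = expR (t * z) * expR ((1 - t) * z).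
      by rewrite -expRD; congr expR; ring.
    by rewrite ler_pM2l ?expR_gt0 // expR_ge1Dx.
  have e2 : expR (t * z) * (1 - t * z) <= 1.
    rewrite -[leRHS](expRxMexpNx_1 (t * z)) ler_pM2l ?expR_gt0 //.
    exact: expR_ge1Dx.
  have f1 := ler_wpM2l t0 e1.
  have f2 : (1 - t) * (expR (t * z) * (1 - t * z)) <= (1 - t) * 1.
    by rewrite ler_wpM2l // subr_ge0.
  nra.
rewrite /dualrad {2}xE.
have -> : t * y * (a * (expR (lograd y) - 1)) =
  y * (a * (t * (expR (lograd y) - 1))) by ring.
by rewrite !ler_pM2l.
Qed.

End DualRadius.

(** * One collinear step at a large dual radius *)

Section OneStepRadius.
Context {R : realType}.
Variables (G k V x : R).
Hypotheses (G0 : 0 < G) (k3 : 3 <= k) (VG : 4 * G ^+ 2 <= V) (xG : x ^+ 2 <= G ^+ 2).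

Let k0 : 0 < k. Proof. by apply: lt_le_trans k3. Qed.
Let G20 : 0 < G ^+ 2. Proof. by rewrite exprn_gt0. Qed.
Let V0 : 0 < V. Proof. by apply: lt_le_trans VG; rewrite mulr_gt0. Qed.
Let x20 : 0 <= x ^+ 2. Proof. exact: sqr_ge0. Qed.
Let V'0 : 0 < V + x ^+ 2. Proof. exact: ltr_wpDr. Qed.

Lemma sqr_norm_le (y z : R) : 0 <= z -> y ^+ 2 <= z ^+ 2 -> - z <= y <= z.
Proof.
by move=> z0 yz; rewrite -ler_norml -(ger0_norm z0) -ler_sqr ?nnegrE // !real_normK ?num_real.
Qed.

Lemma rate_lower (s : R) : 0 <= s -> 9 * V <= s ^+ 2 ->
  9 / (4 * k ^+ 2 * V) <= rate G k V s ^+ 2.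
Proof.
move=> s0 sV; rewrite rate_pos //.
have k2 : 0 < k ^+ 2 by rewrite exprn_gt0.
case: (leP (s / (2 * k * V)) (1 / G)) => _.
  rewrite expr_div_n ler_pdivrMr ?mulr_gt0 // mulrAC ler_pdivlMr; last first.
    by rewrite exprn_gt0 // !mulr_gt0.
  have -> : 9 * (2 * k * V) ^+ 2 = (9 * V) * (4 * k ^+ 2 * V) by ring.
  by rewrite ler_pM2r // !mulr_gt0.
rewrite div1r exprVn ler_pdivrMr ?mulr_gt0 // ler_pdivlMl //.
have : 9 <= k ^+ 2 by rewrite expr2; have := k3; nra.
move=> k9; have := VG; have := G20.
have : 9 * V <= k ^+ 2 * V by rewrite ler_pM2r.
lra.
Qed.

(** Here [|x| <= s / 6] and [x ^+ 2 <= V / 4]: the numerator of the unclipped rate keeps a factor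
    [5/6], the denominator grows by at most [5/4], and the quotient is [2/3]. *)
Lemma rate_shift (s : R) : 0 <= s -> 9 * V <= s ^+ 2 ->
  2 / 3 * rate G k V s <= rate G k (V + x ^+ 2) (s + x).
Proof.
move=> s0 sV; have hV := VG; have hx := xG.
have /andP[xl xu] : - (s / 6) <= x <= s / 6.
  by apply: sqr_norm_le; rewrite ?divr_ge0 // expr_div_n; lra.
rewrite [leRHS](rate_pos _ _ _ G0 k0 V'0); last lra.
rewrite le_min; apply/andP; split; last first.
  apply: le_trans (rate_le _ _ _ G0 s).
  by have := rate_ge0 G k V s; lra.
apply: (@le_trans _ _ (2 / 3 * (s / (2 * k * V)))).
  by rewrite ler_pM2l // rate_lin.
rewrite mulrA ler_pdivrMr ?mulr_gt0 // [leRHS]mulrAC ler_pdivlMr ?mulr_gt0 //.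
have -> : (s + x) * (2 * k * V) = 2 * k * ((s + x) * V) by ring.
have -> : 2 / 3 * s * (2 * k * (V + x ^+ 2)) = 2 * k * (2 / 3 * s * (V + x ^+ 2)) by ring.
rewrite ler_pM2l ?mulr_gt0 //.
have h1 : 2 / 3 * s * (V + x ^+ 2) <= 2 / 3 * s * (5 / 4 * V).
  by rewrite ler_wpM2l //; lra.
have h2 : 5 / 6 * s * V <= (s + x) * V by rewrite ler_pM2r //; lra.
lra.
Qed.

Lemma rate_step_bound (s : R) : - (1 / 3) <= x * rate G k V s / k.
Proof.
have /andP[xl xu] : - G <= x <= G by apply: sqr_norm_le => //; exact: ltW.
rewrite ler_pdivlMr //.
have r0 := rate_ge0 G k V s; have := rate_le G k V G0 s; rewrite ler_pdivlMr // => rG.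
have := k3; nra.
Qed.

(* For [s] large, the drop of [lograd] caused by the growth of [V] absorbs the
   second order term of the shift [s -> s + x]. *)
Lemma lograd_step (s : R) : 0 <= s -> 9 * V <= s ^+ 2 ->
  expR (lograd G k (V + x ^+ 2) (s + x)) <=
  expR (lograd G k V s) * (1 + x * rate G k V s / k).
Proof.
move=> s0 sV.
have hk := k3; have yl := rate_step_bound s.
have lo := rate_lower s s0 sV; have sh := rate_shift s s0 sV.
have e0 := rate_ge0 G k V s.
(* The new rate is a competitor for the old [lograd]; the quadratic gap is kept because it absorbs
   the cross term in [amgm]. *)
have := @lograd_max _ G k V G0 k0 V0 (rate G k (V + x ^+ 2) (s + x)) s.
rewrite rate_ge0 (rate_le _ _ _ G0) => /(_ isT).
rewrite [lograd G k (V + x ^+ 2) (s + x)]/lograd.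
move: yl lo sh e0; set e := rate G k V s; set e' := rate G k (V + x ^+ 2) _.
move=> yl lo sh e0 gap; set y := x * e / k in yl *.
have amgm : x * (e' - e) / k <= V * (e - e') ^+ 2 + x ^+ 2 * (4 * k ^+ 2 * V)^-1.
  have -> : x * (e' - e) / k = V * (e - e') ^+ 2 + x ^+ 2 * (4 * k ^+ 2 * V)^-1
     - V * (e - e' + x / (2 * k * V)) ^+ 2 by field; rewrite !gt_eqF.
  by rewrite gerBl mulr_ge0 ?sqr_ge0 // ltW.
(* By [sh], [e' ^+ 2] is at least [4/9] of [e ^+ 2]. One ninth pays for the first term, by [lo], and
   two ninths pay for the second, by [k >= 3]. *)
have key : (4 * k ^+ 2 * V)^-1 + 2 * e ^+ 2 / k ^+ 2 <= e' ^+ 2.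
  have sh2 : (2 / 3 * e) ^+ 2 <= e' ^+ 2 by rewrite lerXn2r ?nnegrE; lra.
  have : e ^+ 2 / k ^+ 2 <= e ^+ 2 / 9.
    rewrite ler_wpM2l ?sqr_ge0 // lef_pV2 ?posrE ?exprn_gt0 //; nra.
  have -> : (4 * k ^+ 2 * V)^-1 = (9 / (4 * k ^+ 2 * V)) / 9 by field; rewrite !gt_eqF.
  move: lo sh2; rewrite -[2 * _ / _]mulrA; set A := 9 / _; set B := e ^+ 2 / k ^+ 2 => lo sh2 hB.
  have := sqr_ge0 e; lra.
have main : e' * (s + x) / k - e' ^+ 2 * (V + x ^+ 2) <= lograd G k V s + (y - 2 * y ^+ 2).
  have h := ler_wpM2l x20 key.
  have -> : y ^+ 2 = x ^+ 2 * (e ^+ 2 / k ^+ 2) by rewrite /y; field; rewrite gt_eqF.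
  have -> : y = x * e' / k - x * (e' - e) / k by rewrite /y; ring.
  lra.
apply: (@le_trans _ _ (expR (lograd G k V s + (y - 2 * y ^+ 2)))).
  by rewrite ler_expR.
rewrite expRD ler_pM2l ?expR_gt0 //.
(* The bound [exp (y - 2 y^2) <= 1 + y] is taken through reciprocals: [(1 - y + 2 y^2) (1 + y) = 1 +
   y^2 (1 + 2 y)], which is at least [1] since [y >= -1/3]. *)
rewrite -[y - _]opprK expRN -[leRHS]invrK lef_pV2 ?posrE ?expR_gt0 //; last first.
  by rewrite invr_gt0 -/y; lra.
apply: le_trans (expR_ge1Dx _).
rewrite -div1r ler_pdivrMr -/y; last lra.
have -> : (1 + - (y - 2 * y ^+ 2)) * (1 + y) = 1 + y ^+ 2 * (1 + 2 * y) by ring.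
rewrite lerDl mulr_ge0 ?sqr_ge0 // -/y; lra.
Qed.

End OneStepRadius.

(** * One collinear step of the conjugate, at any radius *)

Section OneStep.
Context {R : realType}.

(** [lograd] is a maximum of quantities nonincreasing in [V]. *)
Lemma dualrad_anti (G k V V' a a' s : R) : 0 < G -> 0 < k -> 0 < V -> V <= V' ->
  0 <= a' <= a -> dualrad G k V' a' s <= dualrad G k V a s.
Proof.
move=> G0 k0 V0 VV' /andP[a'0 aa'].
have V'0 : 0 < V' := lt_le_trans V0 VV'.
have le : lograd G k V' s <= lograd G k V s.
  have := lograd_max G k V G0 k0 V0 (rate G k V' s) s.
  rewrite rate_ge0 (rate_le _ _ _ G0) => /(_ isT).
  have : 0 <= V * (rate G k V s - rate G k V' s) ^+ 2.
    by rewrite mulr_ge0 ?sqr_ge0 // ltW.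
  have : rate G k V' s ^+ 2 * V <= rate G k V' s ^+ 2 * V' by rewrite ler_wpM2l ?sqr_ge0.
  rewrite [lograd G k V' s]/lograd; lra.
apply: ler_pM => //.
  by rewrite subr_ge0 -expR0 ler_expR lograd_ge0.
by rewrite lerB // ler_expR.
Qed.

Lemma supports_ge0 (phi m : R -> R) (s : R) : supports phi m -> phi 0 = 0 -> m 0 = 0 ->
  0 <= phi s.
Proof. by move=> sm p0 m0; have := sm s 0; rewrite m0 p0 mul0r subr0. Qed.

Variables (G k V a : R).
Hypotheses (G0 : 0 < G) (k3 : 3 <= k) (VG : 4 * G ^+ 2 <= V) (a0 : 0 < a).

Let k0 : 0 < k. Proof. by apply: lt_le_trans k3. Qed.
Let V0 : 0 < V. Proof. by apply: lt_le_trans VG; rewrite mulr_gt0 // exprn_gt0. Qed.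
Let v := Num.sqrt V.
Let v0 : 0 < v. Proof. by rewrite sqrtr_gt0. Qed.
Let vv : v ^+ 2 = V. Proof. by rewrite sqr_sqrtr // ltW. Qed.

(** The range [c <= 7/2 sqrt V] covers [3 sqrt V] plus a shift of at most [sqrt V / 2]. There
    [rate / k <= 7 / (36 sqrt V)] and [exp lograd <= 1 / (1 - 49/72) = 72/23], with product [14/23]
    of [1 / sqrt V]. *)
Lemma dualrad_lipschitz (b c : R) : 0 <= b <= c -> 4 * c ^+ 2 <= 49 * V ->
  dualrad G k V a c - dualrad G k V a b <= a / v * (c - b).
Proof.
move=> /andP[b0 bc] cV; have c0 : 0 <= c by apply: le_trans bc.
have cv : c <= 7 / 2 * v.
  rewrite -ler_sqr ?nnegrE ?mulr_ge0 ?(ltW v0) // exprMn vv; lra.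
have r1 : rate G k V c / k <= c / (18 * V).
  rewrite ler_pdivrMr //; apply: le_trans (rate_lin G k V k0 V0 c c0) _.
  rewrite -[leRHS]mulrA ler_wpM2l // -div1r ler_pdivrMr ?mulr_gt0 //.
  have -> : (18 * V)^-1 * k * (2 * k * V) = k ^+ 2 / 9 by field; rewrite gt_eqF.
  have := k3; nra.
have r2 : rate G k V c / k <= 7 / (36 * v).
  apply: le_trans r1 _; rewrite ler_pdivrMr ?mulr_gt0 // -vv.
  have -> : 7 / (36 * v) * (18 * v ^+ 2) = 7 / 2 * v by field; rewrite gt_eqF.
  by [].
have f1 : lograd G k V c <= 49 / 72.
  apply: le_trans (lograd_le G k V V0 c c0) _.
  rewrite mulrAC; apply: (@le_trans _ _ (c / (18 * V) * c)).
    by rewrite ler_wpM2r.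
  rewrite mulrAC ler_pdivrMr ?mulr_gt0 // -expr2; lra.
have f2 : expR (lograd G k V c) <= 72 / 23.
  apply: (@le_trans _ _ (expR (49 / 72))); first by rewrite ler_expR.
  rewrite -[49 / 72]opprK expRN -[leRHS]invrK lef_pV2 ?posrE ?expR_gt0 ?invr_gt0 //.
  by apply: le_trans (expR_ge1Dx _); lra.
have := dualrad_supports G k V a G0 k0 V0 a0 b c.
have f3 : expR (lograd G k V c) * (rate G k V c / k) <= v^-1.
  apply: (@le_trans _ _ (72 / 23 * (7 / (36 * v)))).
    by apply: ler_pM => //; rewrite ?expR_ge0 // divr_ge0 ?rate_ge0 // ltW.
  have -> : 72 / 23 * (7 / (36 * v)) = 14 / 23 * v^-1 by field; rewrite gt_eqF.
  rewrite ler_piMl ?invr_ge0 ?(ltW v0) //; lra.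
have f4 : a * (expR (lograd G k V c) * (rate G k V c / k)) * (c - b) <= a / v * (c - b).
  by rewrite ler_wpM2r ?subr_ge0 // ler_pM2l.
lra.
Qed.

Variables (x a' : R) (h h' : R -> R).
Hypotheses (xG : x ^+ 2 <= G ^+ 2) (a'a : 0 < a' <= a).
Hypotheses (hs : supports h (dualrad G k V a)) (h0 : h 0 = 0).
Hypotheses (hs' : supports h' (dualrad G k (V + x ^+ 2) a')) (h0' : h' 0 = 0).

Let V'0 : 0 < V + x ^+ 2. Proof. by apply: ltr_wpDr => //; exact: sqr_ge0. Qed.
Let a'0 : 0 < a'. Proof. by case/andP: a'a. Qed.

Lemma dual_is_derive (t : R) : is_derive t 1 h (dualrad G k V a t).
Proof. exact: (supports_is_derive h _ t hs (dualrad_continuous G k V a G0 k0 V0 a0 t)). Qed.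

Lemma dual'_is_derive (t : R) : is_derive t 1 h' (dualrad G k (V + x ^+ 2) a' t).
Proof.
exact: (supports_is_derive h' _ t hs' (dualrad_continuous G k _ a' G0 k0 V'0 a'0 t)).
Qed.

Lemma dual_anti (s : R) : 0 <= s -> h' s <= h s.
Proof.
move=> s0; have := increment_le_is_derive h' _ h _ 0 s dual'_is_derive dual_is_derive s0.
rewrite h0 h0' !subr0; apply => t _.
by apply: dualrad_anti => //; [rewrite lerDl sqr_ge0|case/andP: a'a => /ltW ->].
Qed.

Lemma dual_step_small (s : R) : 0 <= s -> s ^+ 2 <= 9 * V ->
  h' `|s + x| <= h s + x * dualrad G k V a s + 2 * (a / v * x ^+ 2).
Proof.
move=> s0 sV; apply: le_trans (dual_anti _ (normr_ge0 _)) _.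
have sv : s <= 3 * v.
  rewrite -ler_sqr ?nnegrE ?mulr_ge0 ?(ltW v0) // exprMn vv; lra.
have /andP[xl xu] : - (v / 2) <= x <= v / 2.
  apply: sqr_norm_le; first by rewrite divr_ge0 // ltW.
  rewrite expr_div_n vv; have := xG; have := VG; lra.
have c0 : 0 < a / v by rewrite divr_gt0.
have cx : 0 <= a / v * x ^+ 2 by rewrite mulr_ge0 ?sqr_ge0 // ltW.
have r00 : dualrad G k V a 0 = 0 by apply: dualrad_npos.
have small (c : R) : 0 <= c -> c <= 7 / 2 * v -> 4 * c ^+ 2 <= 49 * V.
  move=> cp cv; have : c ^+ 2 <= (7 / 2 * v) ^+ 2 by rewrite lerXn2r ?nnegrE //; lra.
  rewrite exprMn vv; lra.
have [sx|sx] := leP 0 (s + x).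
  rewrite ger0_norm //; have := hs s (s + x).
  have -> : s - (s + x) = - x by ring.
  suff : x * (dualrad G k V a (s + x) - dualrad G k V a s) <= a / v * x ^+ 2 by lra.
  have [x0|x0] := leP 0 x.
    have := dualrad_lipschitz s (s + x); rewrite s0 lerDl x0 => /(_ isT).
    have -> : s + x - s = x by ring.
    move=> H; rewrite expr2 mulrCA ler_wpM2l //; apply: H; apply: small; lra.
  have := dualrad_lipschitz (s + x) s; rewrite sx gerDl ltW // => /(_ isT).
  have -> : s - (s + x) = - x by ring.
  move=> H; rewrite -[leLHS]mulrNN opprB.
  have -> : a / v * x ^+ 2 = - x * (a / v * - x) by ring.
  rewrite ler_wpM2l //; first lra.
  apply: H; apply: small; lra.
(* The shift crosses the origin. Both [s] and the reflected radius [z] are at most [- x], so [h z]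
   and [- x * dualrad s] each cost [a / v * x ^+ 2]; hence the factor [2]. *)
have sxn : s < - x by lra.
rewrite ltr0_norm //; set z := - (s + x).
have z0 : 0 <= z by rewrite /z; lra.
have zx : z <= - x by rewrite /z; lra.
have := hs 0 z; rewrite h0.
have := dualrad_lipschitz 0 z; rewrite lexx z0 r00 !subr0 => /(_ isT (small _ z0 _)) rz.
have := dualrad_lipschitz 0 s; rewrite lexx s0 r00 !subr0 => /(_ isT (small _ s0 _)) rs.
have hp : 0 <= h s by apply: (supports_ge0 _ _ _ hs).
have {}rz : z * dualrad G k V a z <= - x * (a / v * - x).
  apply: ler_pM => //; first exact: dualrad_ge0.
  apply: le_trans (rz _) _; first by lra.
  by rewrite ler_pM2l.
have {}rs : - x * dualrad G k V a s <= - x * (a / v * - x).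
  rewrite ler_wpM2l //; first lra.
  apply: le_trans (rs _) _; first by lra.
  by rewrite ler_pM2l // ltW.
move: rz rs; have -> : - x * (a / v * - x) = a / v * x ^+ 2 by ring.
set A := a / v * x ^+ 2 => rz rs hz; lra.
Qed.

(** Beyond [3 * v] the inequality propagates from the endpoint [3 * v]: by [lograd_step], the
    derivative in [s] of the left side is at most that of the right side. *)
Lemma dual_step (s : R) : 0 <= s ->
  h' `|s + x| <= h s + x * dualrad G k V a s + 2 * (a / v * x ^+ 2).
Proof.
move=> s0; have [|sV] := leP (s ^+ 2) (9 * V); first exact: dual_step_small.
have hx := xG; have hV := VG.
have tv : 0 <= 3 * v by rewrite mulr_ge0 // ltW.
have tV : (3 * v) ^+ 2 = 9 * V by rewrite exprMn vv; lra.
have vs : 3 * v <= s by rewrite -ler_sqr ?nnegrE // tV ltW.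
have big (t : R) : 3 * v <= t -> 0 <= t + x.
  have /andP[xl xu] : - (3 * v) <= x <= 3 * v.
    by apply: sqr_norm_le => //; rewrite tV; have := V0; lra.
  lra.
have := dual_step_small (3 * v) tv; rewrite tV lexx => /(_ isT).
rewrite !ger0_norm ?big //.
have ds' (t : R) : is_derive t 1 (fun y => h' (y + x)) (dualrad G k (V + x ^+ 2) a' (t + x)).
  apply: (supports_is_derive _ (fun y => dualrad G k (V + x ^+ 2) a' (y + x))).
    by move=> y z; have := hs' (y + x) (z + x); have -> : y + x - (z + x) = y - z by ring.
  apply: (@continuous_comp _ _ _ (fun y : R => y + x)) => /=.
    by apply: continuousD; [exact: cvg_id|exact: cvg_cst].
  exact: dualrad_continuous.
have ds (t : R) : is_derive t 1 (h + x \*: dualrad G k V a)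
    (dualrad G k V a t + x * (a * (expR (lograd G k V t) * (rate G k V t / k)))).
  apply: is_deriveD; first exact: dual_is_derive.
  by apply: is_deriveZ; exact: dualrad_is_derive.
have := increment_le_is_derive _ _ _ _ _ _ ds' ds vs.
rewrite -[(h + _) s]/(h s + x * _ s) -[(h + _) (3 * v)]/(h _ + x * _ (3 * v)).
move=> H h1; suff : forall t : R, 3 * v <= t <= s ->
   dualrad G k (V + x ^+ 2) a' (t + x) <=
   dualrad G k V a t + x * (a * (expR (lograd G k V t) * (rate G k V t / k))).
  by move/H; lra.
move=> t /andP[vt _]; have t0 : 0 <= t by apply: le_trans vt.
apply: (@le_trans _ _ (dualrad G k (V + x ^+ 2) a (t + x))).
  by apply: dualrad_anti => //; case/andP: a'a => /ltW ->.
have t9 : 9 * V <= t ^+ 2 by rewrite -tV lerXn2r ?nnegrE.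
have := lograd_step G k V x G0 k3 VG xG t t0 t9; rewrite -(ler_pM2l a0) /dualrad.
lra.
Qed.

End OneStep.

(** * One step in an arbitrary direction *)

Section OneStepPlanar.
Context {R : realType}.
Variables (G k V a gam a' : R) (h h' : R -> R).
Hypotheses (G0 : 0 < G) (k3 : 3 <= k) (VG : 4 * G ^+ 2 <= V) (a0 : 0 < a).
Hypotheses (gam0 : 0 <= gam) (gamG : gam <= G) (a'a : 0 < a' <= a).
Hypotheses (hs : supports h (dualrad G k V a)) (h0 : h 0 = 0).
Hypotheses (hs' : supports h' (dualrad G k (V + gam ^+ 2) a')) (h0' : h' 0 = 0).

(* A vector of length [s] minus one of length [gam] at angle [arccos c] has length
   [sig]; convexity in [sig ^+ 2] reduces to the collinear cases [c = 1] and [c = -1]. *)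
Lemma dual_step_planar (s c sig : R) : 0 <= s -> -1 <= c <= 1 -> 0 <= sig ->
  sig ^+ 2 = s ^+ 2 - 2 * (c * gam * s) + gam ^+ 2 ->
  h' sig <= h s - c * gam * dualrad G k V a s + 2 * (a / Num.sqrt V * gam ^+ 2).
Proof.
move=> s0 /andP[cl cu] sig0 sigE.
have k0 : 0 < k by apply: lt_le_trans k3.
have V0 : 0 < V by apply: lt_le_trans VG; rewrite mulr_gt0 // exprn_gt0.
have V'0 : 0 < V + gam ^+ 2 by apply: ltr_wpDr => //; exact: sqr_ge0.
have a'0 : 0 < a' by case/andP: a'a.
have g2 : gam ^+ 2 <= G ^+ 2 by rewrite lerXn2r ?nnegrE // ltW.
have up := dual_step G k V a G0 k3 VG a0 gam a' h h' g2 a'a hs h0 hs' h0' s s0.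
have dn : h' `|s - gam| <=
    h s + - gam * dualrad G k V a s + 2 * (a / Num.sqrt V * gam ^+ 2).
  have := dual_step G k V a G0 k3 VG a0 (- gam) a' h h'; rewrite sqrrN.
  by move=> /(_ g2 a'a hs h0 hs' h0' s s0).
(* With this weight, [sig ^+ 2] is the convex combination of [(s + gam) ^+ 2] and [(s - gam) ^+ 2],
   and [c = 1 - 2 * lam]. *)
pose lam := (1 - c) / 2.
have lam0 : 0 <= lam by rewrite /lam divr_ge0 // subr_ge0.
have lam1 : 0 <= 1 - lam by rewrite /lam; lra.
have up' := ler_wpM2l lam0 up; have dn' := ler_wpM2l lam1 dn.
suff : h' sig <= lam * h' `|s + gam| + (1 - lam) * h' `|s - gam|.
  have -> : c = 1 - 2 * lam by rewrite /lam; field.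
  lra.
have h'0 (t : R) : 0 <= h' t.
  by apply: (supports_ge0 _ _ _ hs') => //; apply: dualrad_npos.
have [sig_gt0|] := ltP 0 sig; last first.
  move=> sn; have -> : sig = 0 by apply/eqP; rewrite eq_le sn sig0.
  by rewrite h0' addr_ge0 // mulr_ge0.
(* Tangents at [sig ^+ 2], used at the two collinear radii; their linear terms cancel in the
   weighted sum. *)
have tan (t : R) := supports_sqr h' _ sig `|t| hs'
  (dualrad_continuous G k _ a' G0 k0 V'0 a'0) (dualrad_ratio G k _ a' G0 k0 V'0 a'0)
  (dualrad_ge0 G k _ a' G0 k0 V'0 a'0 sig) sig_gt0 (normr_ge0 t).
have t1 := ler_wpM2l lam0 (tan (s + gam)); have t2 := ler_wpM2l lam1 (tan (s - gam)).
move: t1 t2; rewrite !real_normK ?num_real // sigE; set m := _ / _ => t1 t2.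
have : lam * (m * ((s + gam) ^+ 2 - (s ^+ 2 - 2 * (c * gam * s) + gam ^+ 2))) +
  (1 - lam) * (m * ((s - gam) ^+ 2 - (s ^+ 2 - 2 * (c * gam * s) + gam ^+ 2))) = 0.
  by rewrite /lam; field.
lra.
Qed.

End OneStepPlanar.

(** * Closed form of the regularizer slope and its inverse *)

Section Regularizer.
Context {R : realType}.
Notation mu := (@lebesgue_measure R).
Variables (G k V a : R).
Hypotheses (G0 : 0 < G) (k0 : 0 < k) (V0 : 0 < V) (a0 : 0 < a).

(* The minimum over [0 < e <= 1/G] of [L / e + e V]. *)
Definition tradeoff (L : R) : R :=
  2 * Num.sqrt (V * Num.min L (V / G ^+ 2)) + G * (L - Num.min L (V / G ^+ 2)).

(** The clip extends the slope by [0] to negative [x], which keeps it continuous and monotone on the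
    whole line. *)
Definition reg_slope (x : R) : R := tradeoff (ln (Num.max 0 x / a + 1)).

Definition reg (x : R) : R := k * \int[mu]_(y in `[0, x]) reg_slope y.

Lemma tradeoff_small L : L <= V / G ^+ 2 -> tradeoff L = 2 * Num.sqrt (V * L).
Proof. by move=> LV; rewrite /tradeoff min_l // subrr mulr0 addr0. Qed.

Lemma tradeoff_large L : V / G ^+ 2 <= L -> tradeoff L = V / G + G * L.
Proof.
move=> LV; rewrite /tradeoff min_r //.
have -> : V * (V / G ^+ 2) = (V / G) ^+ 2 by field; rewrite gt_eqF.
by rewrite sqrtr_sqr ger0_norm ?divr_ge0 ?(ltW V0) ?(ltW G0) //; field; rewrite gt_eqF.
Qed.

(** Up to the threshold the gap is a square over [e * V]; beyond it the gap is
    [(1 - e G) (L / e - V / G)] with nonnegative factors. *)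
Lemma tradeoff_lower (L e : R) : 0 <= L -> 0 < e -> e <= 1 / G ->
  tradeoff L <= L / e + e * V.
Proof.
move=> L0 e0 eG; have [LV|LV] := leP L (V / G ^+ 2).
  rewrite tradeoff_small //; set q := Num.sqrt _.
  have qq : q ^+ 2 = V * L by rewrite sqr_sqrtr // mulr_ge0 // ltW.
  rewrite -subr_ge0.
  have -> : L / e + e * V - 2 * q = (q - e * V) ^+ 2 / (e * V).
    have -> : L = q ^+ 2 / V by rewrite qq mulrAC mulfV ?mul1r // gt_eqF.
    by field; rewrite !gt_eqF.
  by rewrite divr_ge0 ?sqr_ge0 // mulr_ge0 // ltW.
rewrite tradeoff_large ?(ltW LV) // -subr_ge0.
have -> : L / e + e * V - (V / G + G * L) = (1 - e * G) * (L / e - V / G).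
  by field; rewrite !gt_eqF.
rewrite ler_pdivlMr // in eG.
rewrite mulr_ge0 ?subr_ge0 // ler_pdivlMr //.
rewrite -[L]mul1r; apply: (@le_trans _ _ (1 * (V / G ^+ 2))); last first.
  by rewrite ler_pM2l // ltW.
have -> : V / G * e = (e * G) * (V / G ^+ 2) by field; rewrite gt_eqF.
by rewrite ler_wpM2r // divr_ge0 ?sqr_ge0 // ltW.
Qed.

Lemma tradeoff_inf (L : R) : 0 <= L ->
  inf [set L / e + e * V | e in [set e : R | 0 < e <= 1 / G]] = tradeoff L.
Proof.
move=> L0; set E := image _ _.
have lbE : lbound E (tradeoff L).
  by move=> _ [e /= /andP[e0 eG] <-]; exact: tradeoff_lower.
have hE : has_lbound E by exists (tradeoff L).
have G10 : 0 < 1 / G by rewrite divr_gt0.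
apply/eqP; rewrite eq_le; apply/andP; split; last first.
  by apply: lb_le_inf => //; exists (L / (1 / G) + 1 / G * V), (1 / G) => //=; rewrite G10 lexx.
have [LV|LV] := leP L (V / G ^+ 2); last first.
  apply: ge_inf => //; exists (1 / G); first by rewrite /= G10 lexx.
  by rewrite tradeoff_large ?(ltW LV) //; field; rewrite gt_eqF.
have [L00|Ln0] := eqVneq L 0.
  have -> : tradeoff L = 0 by rewrite tradeoff_small // L00 mulr0 sqrtr0 mulr0.
  rewrite leNgt; apply/negP => i0.
  (* For [L = 0] the values are [e * V], which tend to [0]; this [e] would give a value of at most
     half a positive infimum. *)
  pose e := Num.min (1 / G) (inf E / (2 * V)).
  have e0 : 0 < e by rewrite lt_min G10 divr_gt0 // mulr_gt0.
  have : inf E <= e * V.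
    apply: ge_inf => //; exists e; first by rewrite /= e0 ge_min lexx.
    by rewrite L00 mul0r add0r.
  have : e * V <= inf E / (2 * V) * V by rewrite ler_pM2r // ge_min lexx orbT.
  have -> : inf E / (2 * V) * V = inf E / 2 by field; rewrite gt_eqF.
  lra.
rewrite tradeoff_small //; set q := Num.sqrt _.
have qq : q ^+ 2 = V * L by rewrite sqr_sqrtr // mulr_ge0 // ltW.
have q0 : 0 < q by rewrite sqrtr_gt0 mulr_gt0 // lt_neqAle eq_sym Ln0.
(* This is the stationary point [sqrt (L / V)], admissible because [L <= V / G ^+ 2]. *)
apply: ge_inf => //; exists (q / V).
  rewrite /= divr_gt0 //= ler_pdivrMr // mul1r.
  rewrite -ler_sqr ?nnegrE ?mulr_ge0 ?invr_ge0 ?(ltW V0) ?(ltW G0) ?(ltW q0) //.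
  have -> : (G^-1 * V) ^+ 2 = V * (V / G ^+ 2) by field; rewrite gt_eqF.
  by rewrite qq ler_pM2l.
have -> : L = q ^+ 2 / V by rewrite qq mulrAC mulfV ?mul1r // gt_eqF.
by field; rewrite !gt_eqF.
Qed.

Lemma tradeoff_continuous : continuous tradeoff.
Proof.
have mc : continuous (fun L : R => Num.min L (V / G ^+ 2)).
  by move=> L; apply: (@continuous_min R R id (cst (V / G ^+ 2)) L); [exact: cvg_id|exact: cvg_cst].
move=> L; rewrite /continuous_at /tradeoff.
apply: cvgD; apply: cvgM; [exact: cvg_cst| |exact: cvg_cst|].
  apply: (@continuous_comp _ _ _ (fun L => V * Num.min L (V / G ^+ 2))); last first.
    exact: sqrt_continuous.
  by apply: cvgM; [exact: cvg_cst|exact: mc].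
by apply: cvgB; [exact: cvg_id|exact: mc].
Qed.

Lemma log_arg_gt0 (x : R) : 0 < Num.max 0 x / a + 1.
Proof. by rewrite ltr_wpDl // divr_ge0 ?(ltW a0) // le_max lexx. Qed.

Lemma log_arg_ge0 (x : R) : 0 <= ln (Num.max 0 x / a + 1).
Proof. by rewrite ln_ge0 // lerDr divr_ge0 ?(ltW a0) // le_max lexx. Qed.

Lemma reg_slope_continuous : continuous reg_slope.
Proof.
move=> x.
have c1 : {for x, continuous (fun y : R => Num.max 0 y / a + 1)}.
  apply: cvgD; last exact: cvg_cst.
  apply: cvgM; last exact: cvg_cst.
  by apply: (@continuous_max R R (cst 0) id x); [exact: cvg_cst|exact: cvg_id].
have c2 := continuous_comp c1 (continuous_ln (log_arg_gt0 x)).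
exact: (continuous_comp c2 (@tradeoff_continuous _)).
Qed.

(** At [s = k * tradeoff L] the rate equals the optimal [e] of the tradeoff, [sqrt (L / V)] or
    [1 / G], and then [lograd] returns [L]. *)
Lemma dualrad_slope (x : R) : 0 <= x -> dualrad G k V a (k * reg_slope x) = x.
Proof.
move=> x0; rewrite /reg_slope; have L0 := log_arg_ge0 x; have := log_arg_gt0 x.
rewrite max_r // in L0 *; set L := ln _ in L0 * => xa.
suff E : lograd G k V (k * tradeoff L) = L.
  by rewrite /dualrad E /L lnK // addrK mulrC divfK // gt_eqF.
have [LV|LV] := leP L (V / G ^+ 2).
  rewrite tradeoff_small //; set q := Num.sqrt _.
  have qq : q ^+ 2 = V * L by rewrite sqr_sqrtr // mulr_ge0 // ltW.
  have q0 : 0 <= q by exact: sqrtr_ge0.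
  have rE : rate G k V (k * (2 * q)) = q / V.
    rewrite rate_pos //; last by rewrite !mulr_ge0 // ltW.
    have -> : k * (2 * q) / (2 * k * V) = q / V by field; rewrite !gt_eqF.
    apply/min_idPl; rewrite ler_pdivrMr // mul1r.
    rewrite -ler_sqr ?nnegrE ?mulr_ge0 ?invr_ge0 ?(ltW V0) ?(ltW G0) //.
    have -> : (G^-1 * V) ^+ 2 = V * (V / G ^+ 2) by field; rewrite gt_eqF.
    by rewrite qq ler_pM2l.
  rewrite /lograd rE.
  have -> : L = q ^+ 2 / V by rewrite qq mulrAC mulfV ?mul1r // gt_eqF.
  by field; rewrite !gt_eqF.
rewrite tradeoff_large ?(ltW LV) //.
have rE : rate G k V (k * (V / G + G * L)) = 1 / G.
  rewrite rate_pos //; last first.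
    by rewrite mulr_ge0 ?addr_ge0 ?divr_ge0 ?mulr_ge0 // ltW.
  have -> : k * (V / G + G * L) / (2 * k * V) = (1 / G + G * L / V) / 2.
    by field; rewrite !gt_eqF.
  apply/min_idPr; rewrite ltr_pdivrMr ?exprn_gt0 // in LV.
  have : 1 / G <= G * L / V.
    rewrite ler_pdivlMr // mulrC mulrA mulr1 ler_pdivrMr //.
    by rewrite mulrAC mulrC -expr2 ltW.
  lra.
by rewrite /lograd rE; field; rewrite !gt_eqF.
Qed.

Lemma slope_dualrad (s : R) : 0 <= s -> k * reg_slope (dualrad G k V a s) = s.
Proof.
move=> s0; rewrite /reg_slope max_r ?dualrad_ge0 //.
have -> : dualrad G k V a s / a + 1 = expR (lograd G k V s).
  by rewrite /dualrad; field; rewrite gt_eqF.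
rewrite expRK; have := rate_pos G k V G0 k0 V0 s s0.
have [sV rE|sV rE] := leP (s / (2 * k * V)) (1 / G).
  have lE : lograd G k V s = (s / (2 * k)) ^+ 2 / V.
    by rewrite /lograd rE; field; rewrite !gt_eqF.
  have sk : 0 <= s / (2 * k) by rewrite divr_ge0 ?mulr_ge0 // ltW.
  rewrite tradeoff_small lE; last first.
    have -> : (s / (2 * k)) ^+ 2 / V = V * (s / (2 * k * V)) ^+ 2 by field; rewrite !gt_eqF.
    have -> : V / G ^+ 2 = V * (1 / G) ^+ 2 by field; rewrite gt_eqF.
    by rewrite ler_pM2l // lerXn2r // nnegrE divr_ge0 ?mulr_ge0 // ltW.
  have -> : V * ((s / (2 * k)) ^+ 2 / V) = (s / (2 * k)) ^+ 2 by field; rewrite !gt_eqF.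
  by rewrite sqrtr_sqr ger0_norm //; field; rewrite gt_eqF.
have lE : lograd G k V s = s / (G * k) - V / G ^+ 2.
  by rewrite /lograd rE; field; rewrite !gt_eqF.
rewrite tradeoff_large lE; first by field; rewrite !gt_eqF.
have -> : s / (G * k) - V / G ^+ 2 = (2 * (s / (2 * k * V)) - 1 / G) * (V / G).
  by field; rewrite !gt_eqF.
have -> : V / G ^+ 2 = 1 / G * (V / G) by field; rewrite gt_eqF.
by rewrite ler_wpM2r ?divr_ge0 ?(ltW V0) ?(ltW G0) //; lra.
Qed.

End Regularizer.

(** * Convexity of the regularizer and its conjugate *)

Section Conjugate.
Context {R : realType}.
Notation mu := (@lebesgue_measure R).
Variables (G k V a : R).
Hypotheses (G0 : 0 < G) (k0 : 0 < k) (V0 : 0 < V) (a0 : 0 < a).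

Lemma tradeoff_mono (L M : R) : L <= M -> tradeoff G V L <= tradeoff G V M.
Proof.
move=> LM; rewrite /tradeoff; set c := V / G ^+ 2.
apply: lerD; rewrite ler_wpM2l ?(ltW G0) //.
  rewrite ler_wsqrtr // ler_wpM2l ?(ltW V0) //.
  by rewrite le_min !ge_min LM lexx orbT.
by case: (leP L c); case: (leP M c) => *; lra.
Qed.

Lemma reg_slope_mono (x y : R) : x <= y -> reg_slope G V a x <= reg_slope G V a y.
Proof.
move=> xy; apply: tradeoff_mono; rewrite ler_ln ?posrE ?log_arg_gt0 // lerD2r.
by rewrite ler_wpM2r ?invr_ge0 ?(ltW a0) // ge_max !le_max lexx xy orbT.
Qed.

Lemma reg_slope_npos (x : R) : x <= 0 -> reg_slope G V a x = 0.
Proof.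
move=> x0; rewrite /reg_slope max_l // mul0r add0r ln1 tradeoff_small.
  by rewrite mulr0 sqrtr0 mulr0.
by rewrite divr_ge0 ?sqr_ge0 // ltW.
Qed.

Lemma reg_slope_ge0 (x : R) : 0 <= reg_slope G V a x.
Proof.
have [x0|x0] := leP x 0; first by rewrite reg_slope_npos.
by rewrite -(reg_slope_npos 0 (lexx 0)) reg_slope_mono // ltW.
Qed.

Lemma reg_slope_integrable (x y : R) :
  mu.-integrable `[x, y] (EFin \o reg_slope G V a).
Proof.
apply: continuous_compact_integrable; first exact: segment_compact.
by apply: continuous_subspaceT; exact: reg_slope_continuous.
Qed.

Lemma reg_npos (x : R) : x <= 0 -> reg G k V a x = 0.
Proof.
rewrite /reg le_eqVlt => /predU1P[->|x0].
  by rewrite set_itv1 Rintegral_set1 mulr0.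
by rewrite set_itv_ge ?Rintegral_set0 ?mulr0 // bnd_simp -ltNge.
Qed.

Lemma reg_increment (x y : R) : 0 <= y -> y <= x ->
  k * reg_slope G V a y * (x - y) <= reg G k V a x - reg G k V a y <=
  k * reg_slope G V a x * (x - y).
Proof.
move=> y0 yx.
have E : reg G k V a x - reg G k V a y =
    k * \int[mu]_(z in `]y, x]) reg_slope G V a z.
  by rewrite /reg -mulrBr Rintegral_itvB ?bnd_simp //; exact: reg_slope_integrable.
have int : mu.-integrable `]y, x] (EFin \o reg_slope G V a).
  apply: (integrableS _ _ _ (reg_slope_integrable y x)) => //.
  exact: subset_itv_oc_cc.
have cst_int c : \int[mu]_(z in `]y, x]) c = c * (x - y).
  rewrite Rintegral_cst //= lebesgue_measure_itv /= lte_fin.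
  move: yx; rewrite le_eqVlt => /predU1P[->|->]; first by rewrite ltxx subrr.
  by rewrite -EFinD.
have icst c : mu.-integrable `]y, x] (EFin \o (fun=> c)).
  apply: (@integrableS _ _ _ mu `[y, x]) => //; first exact: subset_itv_oc_cc.
  apply: continuous_compact_integrable; first exact: segment_compact.
  by apply: continuous_subspaceT => z; exact: cvg_cst.
rewrite E -!mulrA; apply/andP; split; rewrite ler_wpM2l ?(ltW k0) // -cst_int.
  apply: le_Rintegral => // z /=; rewrite in_itv /= => /andP[yz _].
  by rewrite reg_slope_mono // ltW.
apply: le_Rintegral => // z /=; rewrite in_itv /= => /andP[_ zx].
by rewrite reg_slope_mono.
Qed.

(** Monotonicity of the slope bounds each increment of the integral from both sides; for negative
    arguments both the integral and the slope vanish. *)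
Lemma reg_supports : supports (reg G k V a) (fun x => k * reg_slope G V a x).
Proof.
move=> x y; have S0 (z : R) : 0 <= k * reg_slope G V a z.
  by rewrite mulr_ge0 ?reg_slope_ge0 // ltW.
have reg0 : reg G k V a 0 = 0 by exact: reg_npos.
have [y0|y0] := leP y 0.
  rewrite reg_slope_npos ?(ltW y0) // mulr0 mul0r [reg _ _ _ _ y]reg_npos ?(ltW y0) // subr0.
  have [x0|x0] := leP x 0; first by rewrite reg_npos.
  have /andP[+ _] := reg_increment x 0 (lexx 0) (ltW x0).
  by rewrite reg0 !subr0; apply: le_trans; rewrite mulr_ge0 // ltW.
have [x0|x0] := leP x 0.
  have /andP[_] := reg_increment y 0 (lexx 0) (ltW y0).
  rewrite [reg _ _ _ _ x]reg_npos // reg0; have := S0 y.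
  set S := k * _; nra.
have [xy|xy] := leP y x.
  by have /andP[] := reg_increment x y (ltW y0) xy.
have /andP[_] := reg_increment y x (ltW x0) (ltW xy).
lra.
Qed.

Lemma reg_ge0 (x : R) : 0 <= reg G k V a x.
Proof.
apply: (supports_ge0 _ _ _ reg_supports); first exact: reg_npos.
by rewrite reg_slope_npos // mulr0.
Qed.

(** The conjugate of [reg] over [x >= 0], given by its value at the maximiser [dualrad s]. *)
Definition conj_reg (s : R) : R := s * dualrad G k V a s - reg G k V a (dualrad G k V a s).

Lemma fenchel_young (s x : R) : 0 <= x -> s * x - reg G k V a x <= conj_reg s.
Proof.
move=> x0; rewrite /conj_reg; have [s0|s0] := leP s 0.
  rewrite dualrad_npos // mulr0 (reg_npos 0) // subr0.
  by have := reg_ge0 x; nra.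
have := reg_supports x (dualrad G k V a s); rewrite /= slope_dualrad ?(ltW s0) //.
lra.
Qed.

Lemma conj_reg0 : conj_reg 0 = 0.
Proof. by rewrite /conj_reg dualrad_npos // reg_npos // mulr0 subr0. Qed.

(** The maximiser for [t] is a competitor for [s], so [dualrad] is the slope of the conjugate. *)
Lemma conj_reg_supports : supports conj_reg (dualrad G k V a).
Proof.
move=> s t; have := fenchel_young s (dualrad G k V a t) (dualrad_ge0 _ _ _ _ G0 k0 V0 a0 t).
rewrite [conj_reg t]/conj_reg; lra.
Qed.

End Conjugate.

(** * Inner product and Euclidean norm *)

Section EuclideanNorm.
Context {R : realType} {d : nat}.
Implicit Types x y z : 'rV[R]_d.

Lemma dotC x y : dot x y = dot y x.
Proof. by apply: eq_bigr => i _; rewrite mulrC. Qed.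

Lemma dotDl x y z : dot (x + y) z = dot x z + dot y z.
Proof. by rewrite /dot -big_split; apply: eq_bigr => i _; rewrite mxE mulrDl. Qed.

Lemma dotZl (c : R) x y : dot (c *: x) y = c * dot x y.
Proof. by rewrite /dot mulr_sumr; apply: eq_bigr => i _; rewrite mxE mulrA. Qed.

Lemma dotNl x y : dot (- x) y = - dot x y.
Proof. by rewrite -scaleN1r dotZl mulN1r. Qed.

Lemma dotBl x y z : dot (x - y) z = dot x z - dot y z.
Proof. by rewrite dotDl dotNl. Qed.

Lemma dotDr x y z : dot z (x + y) = dot z x + dot z y.
Proof. by rewrite !(dotC z) dotDl. Qed.

Lemma dotZr (c : R) x y : dot x (c *: y) = c * dot x y.
Proof. by rewrite !(dotC x) dotZl. Qed.

Lemma dotBr x y z : dot z (x - y) = dot z x - dot z y.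
Proof. by rewrite !(dotC z) dotBl. Qed.

Lemma dot0l x : dot 0 x = 0.
Proof. by rewrite -(scale0r 0) dotZl mul0r. Qed.

Lemma dot_ge0 x : 0 <= dot x x.
Proof. by apply: sumr_ge0 => i _; rewrite -expr2 sqr_ge0. Qed.

Lemma dot_eq0 x : dot x x = 0 -> x = 0.
Proof.
move/eqP; rewrite psumr_eq0; last by move=> i _; rewrite -expr2 sqr_ge0.
move=> /allP H; apply/rowP => i; rewrite mxE; apply/eqP.
by have := H i (mem_index_enum i); rewrite mulf_eq0 orbb.
Qed.

Lemma enorm_ge0 x : 0 <= enorm x.
Proof. exact: sqrtr_ge0. Qed.

Lemma enorm_sqr x : enorm x ^+ 2 = dot x x.
Proof. by rewrite sqr_sqrtr // dot_ge0. Qed.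

Lemma enorm0 : enorm (0 : 'rV[R]_d) = 0.
Proof. by rewrite /enorm dot0l sqrtr0. Qed.

Lemma enorm_eq0 x : enorm x = 0 -> x = 0.
Proof. by move=> x0; apply: dot_eq0; rewrite -enorm_sqr x0 expr0n. Qed.

Lemma enormZ (c : R) x : enorm (c *: x) = `|c| * enorm x.
Proof. by rewrite /enorm dotZl dotZr mulrA -expr2 sqrtrM ?sqr_ge0 // sqrtr_sqr. Qed.

Lemma cauchy_schwarz x y : dot x y <= enorm x * enorm y.
Proof.
have [x0|x0] := eqVneq (enorm x) 0.
  by rewrite (enorm_eq0 _ x0) dot0l enorm0 mul0r.
have [y0|y0] := eqVneq (enorm y) 0.
  by rewrite (enorm_eq0 _ y0) dotC dot0l enorm0 mulr0.
have xy : 0 < enorm x * enorm y by rewrite mulr_gt0 // lt_neqAle eq_sym ?x0 ?y0 enorm_ge0.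
rewrite -(ler_pM2l xy).
have := dot_ge0 (enorm y *: x - enorm x *: y).
rewrite !(dotBl, dotBr, dotZl, dotZr) -!enorm_sqr (dotC y x); lra.
Qed.

Lemma abs_cauchy_schwarz x y : `|dot x y| <= enorm x * enorm y.
Proof.
rewrite ler_norml cauchy_schwarz andbT lerNl -dotNl.
by apply: le_trans (cauchy_schwarz _ _) _; rewrite -scaleN1r enormZ normrN1 mul1r.
Qed.

End EuclideanNorm.

(** * Gradients of radial convex functions *)

Section RadialGradient.
Context {R : realType} {d : nat}.
Variables (phi m : R -> R).
Hypotheses (phim : supports phi m) (mc : continuous m) (m0 : m 0 = 0).
Hypothesis mge0 : forall x, 0 <= m x.
Implicit Types v w y z theta : 'rV[R]_d.

(* At the origin the junk value [m 0 / 0 = 0] gives the correct gradient. *)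
Definition radial_grad y : 'rV[R]_d := (m (enorm y) / enorm y) *: y.

Lemma radial_supports y z :
  dot (radial_grad y) (z - y) <= phi (enorm z) - phi (enorm y).
Proof.
apply: le_trans (phim _ _); rewrite dotZl dotBr -enorm_sqr.
have [->|y0] := eqVneq (enorm y) 0; first by rewrite invr0 mulr0 mul0r m0 mul0r.
have -> : m (enorm y) * (enorm z - enorm y) =
    m (enorm y) / enorm y * (enorm y * enorm z - enorm y ^+ 2) by field.
by rewrite ler_wpM2l ?divr_ge0 ?enorm_ge0 // lerB // cauchy_schwarz.
Qed.

Lemma enorm_line_continuous y v : continuous (fun h : R => enorm (h *: v + y)).
Proof.
have E : (fun h : R => enorm (h *: v + y)) = Num.sqrt \o
    (fun h => h ^+ 2 * dot v v + h * (2 * dot v y) + dot y y).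
  apply/funext => h; rewrite /= /enorm; congr Num.sqrt.
  by rewrite !(dotDl, dotDr, dotZl, dotZr) (dotC y v); ring.
rewrite E => h; apply: continuous_comp; last exact: sqrt_continuous.
apply: cvgD; last exact: cvg_cst.
apply: cvgD; apply: cvgM; try exact: cvg_cst; last exact: cvg_id.
exact: exprn_continuous.
Qed.

(** Away from the origin the quotient is continuous; at the origin the value is squeezed by
    [m (enorm z) * enorm v], which tends to [0]. *)
Lemma radial_grad_line_continuous y v :
  {for 0, continuous (fun h : R => dot (radial_grad (h *: v + y)) v)}.
Proof.
have nc : enorm (h *: v + y) @[h --> 0] --> enorm y.
  have := enorm_line_continuous y v 0; rewrite /continuous_at /=.
  by rewrite scale0r add0r.
have smc : m (enorm (h *: v + y)) @[h --> 0] --> m (enorm y).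
  exact: (cvg_comp _ _ nc (mc _)).
suff : dot (radial_grad (h *: v + y)) v @[h --> 0] --> dot (radial_grad (0 *: v + y)) v by [].
rewrite scale0r add0r /radial_grad.
have [y0|y0] := eqVneq (enorm y) 0.
  rewrite y0 invr0 mulr0 scale0r dot0l.
  have bound (h : R) : `|dot ((m (enorm (h *: v + y)) / enorm (h *: v + y)) *: (h *: v + y)) v|
      <= m (enorm (h *: v + y)) * enorm v.
    set z := h *: v + y; apply: le_trans (abs_cauchy_schwarz _ _) _.
    rewrite ler_wpM2r ?enorm_ge0 // enormZ ger0_norm ?divr_ge0 ?enorm_ge0 //.
    have [->|z0] := eqVneq (enorm z) 0; first by rewrite mulr0.
    by rewrite divfK.
  have b0 : m (enorm (h *: v + y)) * enorm v @[h --> 0] --> m (enorm y) * enorm v.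
    by apply: cvgM; [exact: smc|exact: cvg_cst].
  rewrite y0 m0 mul0r in b0.
  have := cvgN b0; rewrite oppr0 => nb0; apply: (squeeze_cvgr _ (nb0 _) b0).
  by apply: nearW => h; rewrite -ler_norml; exact: bound.
under eq_fun do rewrite dotZl dotDl dotZl.
suff : m (enorm (h *: v + y)) / enorm (h *: v + y) * (h * dot v v + dot y v)
    @[h --> 0] --> m (enorm y) / enorm y * (0 * dot v v + dot y v).
  by rewrite mul0r add0r dotZl.
apply: cvgM; first by apply: cvgM => //; apply: cvgV.
apply: cvgD; last exact: cvg_cst.
by apply: cvgM; [exact: cvg_id|exact: cvg_cst].
Qed.

Lemma radial_line_supports y v : supports (fun h => phi (enorm (h *: v + y)))
  (fun h => dot (radial_grad (h *: v + y)) v).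
Proof.
move=> h e; apply: le_trans (radial_supports _ _).
have -> : h *: v + y - (e *: v + y) = (h - e) *: v.
  by rewrite opprD addrACA subrr addr0 scalerBl.
by rewrite dotZr mulrC.
Qed.

Lemma gradient_radial y : gradient (fun z => phi (enorm z)) y = radial_grad y.
Proof.
apply/rowP => i; rewrite mxE; set v := delta_mx 0 i.
have -> : radial_grad y 0 i = dot (radial_grad y) v.
  rewrite /dot (bigD1 i) //= big1 ?addr0 => [|j ji]; rewrite !mxE eqxx ?eqxx /= ?mulr1 //.
  by rewrite (negbTE ji) mulr0.
have := supports_cvg _ _ (radial_line_supports y v) (radial_grad_line_continuous y v).
rewrite !scale0r !add0r => cv; exact: cvg_lim.
Qed.

(** Test along [v = theta - radial_grad w]: for [h > 0], [dot theta v] is at most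
    [dot (radial_grad (h *: v + w)) v], and [h -> 0] leaves [dot v v <= 0]. *)
Lemma radial_grad_unique theta w :
  (forall z, dot theta (z - w) <= phi (enorm z) - phi (enorm w)) ->
  theta = radial_grad w.
Proof.
move=> opt; pose v := theta - radial_grad w.
suff : dot v v <= 0.
  by move=> v0; apply/eqP; rewrite -subr_eq0; apply/eqP/dot_eq0/eqP; rewrite eq_le v0 dot_ge0.
rewrite {1}/v dotBl subr_le0.
have cv : dot (radial_grad (h *: v + w)) v @[h --> 0] --> dot (radial_grad (0 *: v + w)) v.
  exact: radial_grad_line_continuous.
rewrite scale0r add0r in cv.
have {}cv := cvg_at_right_filter cv.
rewrite -(cvg_lim _ cv) //; apply: limr_ge; first by apply/cvg_ex; eexists; exact: cv.
near=> h; have h0 : 0 < h by near: h; exact: nbhs_right_gt.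
have := opt (h *: v + w); rewrite addrK dotZr => lo.
have := radial_line_supports w v 0 h; rewrite /= scale0r !add0r => up.
rewrite -(ler_pM2l h0); lra.
Unshelve. all: by end_near. Qed.

End RadialGradient.

(** * Telescoping along the inverse logarithm *)

Section LogSum.
Context {R : realType}.
Implicit Types x y : R.

Lemma ln4_ge1 : 1 <= ln (4 : R).
Proof.
have h : ln (1 + - (1 / 2)) <= - (1 / 2) :> R by apply: le_ln1Dx; lra.
have -> : (4 : R) = 2 * 2 by ring.
rewrite lnM ?posrE //.
have -> : ln (2 : R) = - ln (1 + - (1 / 2)).
  by rewrite -lnV ?posrE; [congr ln; field|lra].
lra.
Qed.

(* A discrete form of [(- 1 / ln)' x = 1 / (x ln^2 x)]. *)
Lemma ln_telescope x y : 4 <= x -> x <= y <= x + 1 ->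
  (y - x) / (x * ln x ^+ 2) <= 2 * ((ln x)^-1 - (ln y)^-1).
Proof.
move=> x4 /andP[xy yx].
have x0 : 0 < x by lra.
have y0 : 0 < y by lra.
have lx : 1 <= ln x by apply: le_trans ln4_ge1 _; rewrite ler_ln ?posrE.
have ly : ln x <= ln y by rewrite ler_ln ?posrE.
have lx0 : 0 < ln x by lra.
have ly0 : 0 < ln y by lra.
have r0 : 0 <= (y - x) / x by rewrite divr_ge0 ?subr_ge0 // ltW.
have up : ln y <= ln x + (y - x) / x.
  have -> : y = x * (1 + (y - x) / x) by field; rewrite gt_eqF.
  rewrite lnM ?posrE //; last lra.
  have -> : (x * (1 + (y - x) / x) - x) / x = (y - x) / x by field; rewrite gt_eqF.
  by rewrite lerD2l le_ln1Dx //; lra.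
(* From [ln y - ln x >= (y - x) / y] and [y <= x + 1 <= 5/4 x]. *)
have lo : 4 / 5 * ((y - x) / x) <= ln y - ln x.
  have : ln (x / y) <= x / y - 1.
    have {1}-> : x / y = 1 + (x / y - 1) by ring.
    by apply: le_ln1Dx; rewrite ltrBrDr addNr divr_gt0.
  rewrite ln_div ?posrE // => h.
  suff : 4 / 5 * ((y - x) / x) <= (y - x) / y.
    have -> : (y - x) / y = 1 - x / y by field; rewrite gt_eqF.
    lra.
  rewrite mulrCA ler_wpM2l ?subr_ge0 // ler_pdivrMr // [leRHS]mulrC ler_pdivlMr //; lra.
have r1 : (y - x) / x <= 1 / 4 by rewrite ler_pdivrMr //; lra.
have up2 : ln y <= 5 / 4 * ln x by lra.
have -> : (ln x)^-1 - (ln y)^-1 = (ln y - ln x) / (ln x * ln y).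
  by field; rewrite !gt_eqF.
have -> : (y - x) / (x * ln x ^+ 2) = (y - x) / x / ln x ^+ 2.
  by field; rewrite !gt_eqF.
rewrite ler_pdivrMr ?exprn_gt0 // mulrAC mulrA ler_pdivlMr ?mulr_gt0 //.
set r := (y - x) / x in r0 r1 up lo *; set p := ln x in lx ly lx0 up lo up2 *.
set q := ln y in ly ly0 up lo up2 *.
(* Two losses of [5/4], here and in [lo], give the constant [25/16], below [2]. *)
have h1 : r * (p * q) <= r * (5 / 4 * p ^+ 2).
  rewrite ler_wpM2l // expr2 mulrCA ler_pM2l //.
have h2 : 4 / 5 * r * p ^+ 2 <= (q - p) * p ^+ 2 by rewrite ler_pM2r ?exprn_gt0.
have : 0 <= r * p ^+ 2 by rewrite mulr_ge0 ?sqr_ge0.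
lra.
Qed.

End LogSum.

(** * The parameters of the algorithm and one step of the potential *)

Section Regret.
Context {R : realType} {d : nat}.
Variables (G eps k : R) (g : nat -> 'rV[R]_d).
Hypotheses (G_gt0 : 0 < G) (eps_gt0 : 0 < eps) (k_ge3 : 3 <= k).
Notation V := (Vsum G g).
Notation alf := (alpha G eps g).
Notation slp t := (fun x => k * reg_slope G (V t) (alf t) x).
Notation conj t := (conj_reg G k (V t) (alf t)).

Let k0 : 0 < k. Proof. by apply: lt_le_trans k_ge3. Qed.

Lemma VsumS t : (1 <= t)%N -> V t.+1 = V t + enorm (g t) ^+ 2.
Proof. by move=> t1; rewrite /Vsum big_nat_recr //= addrA. Qed.

Lemma Vsum_ge t : 4 * G ^+ 2 <= V t.
Proof. by rewrite lerDl sumr_ge0 // => s _; rewrite sqr_ge0. Qed.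

Lemma Vsum_gt0 t : 0 < V t.
Proof. by apply: lt_le_trans (Vsum_ge t); rewrite mulr_gt0 // exprn_gt0. Qed.

Lemma Vratio_ge t : 4 <= V t / G ^+ 2.
Proof. by rewrite ler_pdivlMr ?exprn_gt0 // Vsum_ge. Qed.

Lemma lnV_ge1 t : 1 <= ln (V t / G ^+ 2).
Proof.
apply: le_trans ln4_ge1 _; rewrite ler_ln ?posrE ?Vratio_ge //.
by rewrite divr_gt0 ?Vsum_gt0 // exprn_gt0.
Qed.

Lemma alpha_gt0 t : 0 < alf t.
Proof.
have L0 : 0 < ln (V t / G ^+ 2) by apply: lt_le_trans (lnV_ge1 t).
by rewrite /alpha divr_gt0 ?mulr_gt0 ?sqrtr_gt0 ?Vsum_gt0 ?exprn_gt0.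
Qed.

Lemma alpha_decr t : (1 <= t)%N -> alf t.+1 <= alf t.
Proof.
move=> t1; have L1 := lnV_ge1 t; have L2 := lnV_ge1 t.+1.
have sV n : 0 < Num.sqrt (V n) by rewrite sqrtr_gt0 Vsum_gt0.
have VV : V t <= V t.+1 by rewrite VsumS // lerDl sqr_ge0.
rewrite /alpha ler_wpM2l ?mulr_ge0 ?(ltW eps_gt0) ?(ltW G_gt0) //.
have L1' : 0 < ln (V t / G ^+ 2) by lra.
have L2' : 0 < ln (V t.+1 / G ^+ 2) by lra.
rewrite lef_pV2 ?posrE ?mulr_gt0 ?exprn_gt0 ?sV //.
apply: ler_pM; rewrite ?sqrtr_ge0 ?sqr_ge0 //; first by rewrite ler_wsqrtr.
apply: lerXn2r; rewrite ?nnegrE ?(ltW L1') ?(ltW L2') //.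
have V0 n : V n / G ^+ 2 \in Num.pos by rewrite posrE divr_gt0 ?Vsum_gt0 // exprn_gt0.
by rewrite ler_ln // ler_pM2r // invr_gt0 exprn_gt0.
Qed.

Lemma psi_reg t : psi G eps k g t = fun z => reg G k (V t) (alf t) (enorm z).
Proof.
apply/funext => z; rewrite /psi /reg; congr (_ * _); apply: eq_Rintegral => x.
rewrite inE /= in_itv /= => /andP[x0 _].
rewrite /psi_slope tradeoff_inf ?Vsum_gt0 //; first by rewrite /reg_slope max_r.
by rewrite ln_ge0 // lerDr divr_ge0 // ltW // alpha_gt0.
Qed.

Lemma slp_supports t : supports (reg G k (V t) (alf t)) (slp t).
Proof. exact: reg_supports (Vsum_gt0 t) (alpha_gt0 t). Qed.

Lemma slp_continuous t : continuous (slp t).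
Proof.
move=> x; apply: cvgM; first exact: cvg_cst.
exact: (reg_slope_continuous G (V t) (alf t) (alpha_gt0 t)).
Qed.

Lemma slp0 t : slp t 0 = 0.
Proof. by rewrite /= reg_slope_npos ?Vsum_gt0 // mulr0. Qed.

Lemma slp_ge0 t x : 0 <= slp t x.
Proof. by rewrite mulr_ge0 ?(ltW k0) // reg_slope_ge0 // ?Vsum_gt0 // alpha_gt0. Qed.

Lemma gradient_psi t y : gradient (psi G eps k g t) y = radial_grad (slp t) y.
Proof.
rewrite psi_reg; apply: gradient_radial (slp_supports t) (slp_continuous t) (slp0 t) _ y.
exact: slp_ge0.
Qed.

(** The slope at [enorm u] bounds the integral. Beyond the threshold, [V / G <= G * L] turns
    [V / G + G * L] into at most [2 * G * L]. *)
Lemma psi_bound t (u : 'rV[R]_d) :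
  psi G eps k g t u <= 2 * k * enorm u *
    Num.max (Num.sqrt (V t * ln (enorm u / alf t + 1))) (G * ln (enorm u / alf t + 1)).
Proof.
have u0 := enorm_ge0 u; have := slp_supports t 0 (enorm u).
rewrite psi_reg reg_npos // /reg_slope max_r //; set L := ln _; set M := Num.max _ _.
suff : tradeoff G (V t) L <= 2 * M.
  rewrite -(ler_pM2l k0) => h.
  have := ler_wpM2r u0 h; lra.
have [LV|LV] := leP L (V t / G ^+ 2).
  by rewrite tradeoff_small // ler_pM2l // le_max lexx.
rewrite tradeoff_large ?(ltW LV) ?Vsum_gt0 //.
have : V t / G <= G * L.
  have -> : V t / G = G * (V t / G ^+ 2) by field; rewrite gt_eqF.
  by rewrite ler_pM2l // ltW.
have : G * L <= M by rewrite le_max lexx orbT.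
lra.
Qed.

(** This is [ln_telescope] at [V_t / G^2] and [V_{t+1} / G^2], whose distance [|g_t|^2 / G^2] is at
    most [1]. The factor [1 / sqrt V_t] in [alpha] completes the denominator [V_t ln^2]. *)
Lemma stability t : (1 <= t)%N -> enorm (g t) <= G ->
  2 * (alf t / Num.sqrt (V t) * enorm (g t) ^+ 2) <=
  4 * G * eps * ((ln (V t / G ^+ 2))^-1 - (ln (V t.+1 / G ^+ 2))^-1).
Proof.
move=> t1 gG; have V0 := Vsum_gt0 t; have L1 := lnV_ge1 t.
have L0 : 0 < ln (V t / G ^+ 2) by apply: lt_le_trans L1.
have := ln_telescope (V t / G ^+ 2) (V t.+1 / G ^+ 2) (Vratio_ge t).
have G2 : 0 < G ^+ 2 by rewrite exprn_gt0.
have x4 := Vratio_ge t.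
have VE : V t.+1 / G ^+ 2 = V t / G ^+ 2 + enorm (g t) ^+ 2 / G ^+ 2.
  by rewrite VsumS // [LHS]mulrDl.
have r0 : 0 <= enorm (g t) ^+ 2 / G ^+ 2 by rewrite divr_ge0 ?sqr_ge0 // ltW.
have r1 : enorm (g t) ^+ 2 / G ^+ 2 <= 1.
  by rewrite ler_pdivrMr // mul1r lerXn2r ?nnegrE ?enorm_ge0 ?(ltW G_gt0).
have : V t / G ^+ 2 <= V t.+1 / G ^+ 2 <= V t / G ^+ 2 + 1 by rewrite VE lerDl lerD2l r0.
move=> xy /(_ xy); rewrite -(ler_pM2l (x := 2 * eps * G)) ?mulr_gt0 //.
have -> : 2 * (alf t / Num.sqrt (V t) * enorm (g t) ^+ 2) =
  2 * eps * G * ((V t.+1 / G ^+ 2 - V t / G ^+ 2) /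
    (V t / G ^+ 2 * ln (V t / G ^+ 2) ^+ 2)).
  have -> : V t.+1 / G ^+ 2 - V t / G ^+ 2 = enorm (g t) ^+ 2 / G ^+ 2 by rewrite VE addrC addKr.
  rewrite /alpha; move: L0; set L := ln _ => L0.
  have v0 : 0 < Num.sqrt (V t) by rewrite sqrtr_gt0.
  have := sqr_sqrtr (ltW V0); move: v0; set v := Num.sqrt _ => v0 <-.
  by field; rewrite !gt_eqF.
lra.
Qed.

Lemma dual_radius t theta (w : 'rV[R]_d) : theta = radial_grad (slp t) w ->
  dualrad G k (V t) (alf t) (enorm theta) = enorm w.
Proof.
move=> ->; have -> : enorm (radial_grad (slp t) w) = slp t (enorm w).
  rewrite enormZ ger0_norm; last by rewrite divr_ge0 ?enorm_ge0 // slp_ge0.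
  have [->|w0] := eqVneq (enorm w) 0; first by rewrite mulr0 slp0.
  by rewrite divfK.
by apply: dualrad_slope; rewrite ?enorm_ge0 ?Vsum_gt0 ?alpha_gt0.
Qed.

Lemma conj_step t theta (w : 'rV[R]_d) : (1 <= t)%N -> enorm (g t) <= G ->
  theta = radial_grad (slp t) w ->
  conj t.+1 (enorm (theta - g t)) <= conj t (enorm theta) - dot (g t) w +
    4 * G * eps * ((ln (V t / G ^+ 2))^-1 - (ln (V t.+1 / G ^+ 2))^-1).
Proof.
move=> t1 gG thE; have rE := dual_radius t theta w thE.
have := stability t t1 gG; set del := 4 * G * eps * _ => st.
(* The cosine between [g t] and [w], hence also between [g t] and [theta], a nonnegative multiple of
   [w]. If [g t] or [w] is zero, division by zero gives [c = 0], which satisfies [cE] and [cb]. *)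
pose c := dot (g t) w / (enorm (g t) * enorm w).
have cE : c * (enorm (g t) * enorm w) = dot (g t) w.
  rewrite /c; have [/eqP|gw0] := eqVneq (enorm (g t) * enorm w) 0; last by rewrite divfK.
  rewrite mulf_eq0 => /orP[] /eqP /enorm_eq0 ->.
    by rewrite enorm0 dot0l !mul0r.
  by rewrite enorm0 dotC dot0l !mul0r.
have cb : -1 <= c <= 1.
  rewrite -ler_norml /c normf_div [`|_ * _|]ger0_norm; last by rewrite mulr_ge0 ?enorm_ge0.
  have [->|gw0] := eqVneq (enorm (g t) * enorm w) 0; first by rewrite invr0 mulr0.
  rewrite ler_pdivrMr ?mul1r ?abs_cauchy_schwarz //.
  by rewrite lt_neqAle eq_sym gw0 mulr_ge0 ?enorm_ge0.
have thg : dot theta (g t) = c * enorm (g t) * enorm theta.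
  have [w0|w0] := eqVneq (enorm w) 0.
    by rewrite thE (enorm_eq0 _ w0) /radial_grad scaler0 enorm0 dot0l mulr0.
  rewrite thE enormZ dotZl ger0_norm; last by rewrite divr_ge0 ?enorm_ge0 // slp_ge0.
  by rewrite dotC -cE; ring.
have VS := VsumS t t1.
have := dual_step_planar G k (V t) (alf t) (enorm (g t)) (alf t.+1) (conj t) (conj t.+1)
  G_gt0 k_ge3 (Vsum_ge t) (alpha_gt0 t) (enorm_ge0 _) gG.
rewrite alpha_gt0 alpha_decr // => /(_ isT).
have cs n : supports (conj n) (dualrad G k (V n) (alf n)).
  by apply: conj_reg_supports; rewrite ?Vsum_gt0 ?alpha_gt0.
have c0 n : conj n 0 = 0 by apply: conj_reg0; rewrite ?Vsum_gt0.
move=> /(_ (cs t) (c0 t)); have := cs t.+1; rewrite {2}VS => cs1 /(_ cs1 (c0 t.+1)).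
move=> /(_ (enorm theta) c (enorm (theta - g t)) (enorm_ge0 _) cb (enorm_ge0 _)).
rewrite rE -[c * _ * enorm w]mulrA cE => step.
apply: le_trans (step _) _; last by rewrite lerD2l.
rewrite !enorm_sqr dotBl !dotBr (dotC (g t) theta) thg; ring.
Qed.

(** * The iterates and their regret *)

Variables (T : nat) (l : nat -> 'rV[R]_d -> R) (w : nat -> 'rV[R]_d).
Hypothesis l_lip : forall t : nat, (1 <= t <= T)%N -> elipschitz G (l t).
Hypothesis g_sub : forall t : nat, (1 <= t <= T)%N -> subdifferential (l t) (w t) (g t).
Hypothesis w_init : w 1%N = 0.
Hypothesis w_step : forall t : nat, (1 <= t <= T)%N ->
  argmin (md_objective G eps k g w t) (w t.+1).

(** Compare the subgradient inequality with the Lipschitz bound at the point [g t + w t]. *)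
Lemma subgradient_bound t : (1 <= t <= T)%N -> enorm (g t) <= G.
Proof.
move=> tT; have := g_sub t tT (g t + w t); rewrite addrK -enorm_sqr => h1.
have := l_lip t tT (g t + w t) (w t); rewrite addrK => h2.
have h3 := le_trans (ler_norm _) h2.
have [->|g0] := eqVneq (enorm (g t)) 0; first exact: ltW.
have gp : 0 < enorm (g t) by rewrite lt_neqAle eq_sym g0 enorm_ge0.
rewrite -(ler_pM2r gp) -expr2; lra.
Qed.

Definition theta t : 'rV[R]_d := - \sum_(1 <= s < t) g s.

Lemma thetaS t : (1 <= t)%N -> theta t.+1 = theta t - g t.
Proof. by move=> t1; rewrite /theta big_nat_recr //= opprD. Qed.

Lemma iterate_dual n : (n <= T)%N -> theta n.+1 = radial_grad (slp n.+1) (w n.+1).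
Proof.
elim: n => [_|n IH nT].
  by rewrite w_init /theta big_geq // oppr0 /radial_grad scaler0.
apply: (radial_grad_unique _ _ (slp_supports n.+2) (slp_continuous n.+2) (slp0 n.+2)
  (slp_ge0 n.+2)) => z.
(* Since [w 1 = 0], the gradients in [Delta] vanish, and the induction hypothesis turns the gradient
   at the current iterate into [theta]. Up to a constant, the objective is [psi_{n+2}] minus the
   pairing with [theta n.+2]. *)
have := w_step n.+1; rewrite nT => /(_ isT z).
rewrite /md_objective /Delta /bregman !gradient_psi -IH ?(ltnW nT) // w_init.
rewrite /radial_grad !scaler0 !dot0l (thetaS n.+1) // !psi_reg !dotBl !dotBr.
lra.
Qed.

(** The conjugate is the potential and [conj_step] its one-step change. The leading [1] makes the
    right side nonnegative at the start. *)
Lemma regret_invariant n : (n <= T)%N ->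
  \sum_(1 <= s < n.+1) dot (g s) (w s) + conj n.+1 (enorm (theta n.+1)) <=
  4 * G * eps * (1 - (ln (V n.+1 / G ^+ 2))^-1).
Proof.
elim: n => [_|n IH nT].
  rewrite big_geq // /theta big_geq // oppr0 enorm0 conj_reg0 ?Vsum_gt0 // addr0.
  rewrite !mulr_ge0 ?(ltW G_gt0) ?(ltW eps_gt0) // subr_ge0.
  by rewrite invf_le1 ?lnV_ge1 //; apply: lt_le_trans (lnV_ge1 1%N).
have nT' := ltnW nT.
have gG : enorm (g n.+1) <= G by apply: subgradient_bound; rewrite nT.
have := conj_step n.+1 (theta n.+1) (w n.+1) isT gG (iterate_dual n nT').
rewrite -thetaS // big_nat_recr //=; have := IH nT'.
lra.
Qed.

(** Subgradients linearise the losses; Cauchy-Schwarz and Fenchel-Young then trade the final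
    potential and the comparator term for [psi] at [u]. *)
Lemma linear_regret (u : 'rV[R]_d) :
  \sum_(1 <= t < T.+1) (l t (w t) - l t u) <= 4 * G * eps + psi G eps k g T.+1 u.
Proof.
apply: (@le_trans _ _ (\sum_(1 <= t < T.+1) (dot (g t) (w t) - dot (g t) u))).
  rewrite !big_nat; apply: ler_sum => t tT.
  have := g_sub t tT u; rewrite dotBr; lra.
rewrite sumrB; have := regret_invariant T (leqnn T).
have -> : \sum_(1 <= t < T.+1) dot (g t) u = - dot (theta T.+1) u.
  rewrite /theta dotNl opprK.
  by elim/big_rec2: _ => [|i y x _ ->]; rewrite ?dot0l // dotDl.
have := fenchel_young G k (V T.+1) (alf T.+1) G_gt0 k0 (Vsum_gt0 _) (alpha_gt0 _)
  (enorm (theta T.+1)) (enorm u) (enorm_ge0 u).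
have := cauchy_schwarz (theta T.+1) u.
have : 0 <= 4 * G * eps * (ln (V T.+1 / G ^+ 2))^-1.
  rewrite !mulr_ge0 ?(ltW G_gt0) ?(ltW eps_gt0) // invr_ge0.
  exact: le_trans (lnV_ge1 _).
rewrite psi_reg; lra.
Qed.

End Regret.

Theorem theorem1 (R : realType) (d T : nat) (G eps k : R)
    (l : nat -> 'rV[R]_d -> R) (g w : nat -> 'rV[R]_d)
    (G_gt0 : 0 < G) (eps_gt0 : 0 < eps) (k_ge3 : 3 <= k)
    (l_lip : forall t : nat, (1 <= t <= T)%N -> elipschitz G (l t))
    (l_cvx : forall t : nat, (1 <= t <= T)%N ->
      convex_function (E := 'rV[R]_d) setT (l t))
    (g_sub : forall t : nat, (1 <= t <= T)%N -> subdifferential (l t) (w t) (g t))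
    (w_init : w 1%N = 0)
    (w_step : forall t : nat, (1 <= t <= T)%N ->
      argmin (md_objective G eps k g w t) (w t.+1)) :
  forall u : 'rV[R]_d,
    \sum_(1 <= t < T.+1) (l t (w t) - l t u) <=
      4 * G * eps
      + 2 * k * enorm u *
        Num.max
          (Num.sqrt (Vsum G g T.+1 * ln (enorm u / alpha G eps g T.+1 + 1)))
          (G * ln (enorm u / alpha G eps g T.+1 + 1)).
Proof.
move=> u.
apply: le_trans (linear_regret G eps k g G_gt0 eps_gt0 k_ge3 T l w l_lip g_sub w_init w_step u) _.
by rewrite lerD2l; apply: psi_bound.
Qed.
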